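(* Let $n,b$ be natural numbers with $1<n<b$, let $k\ge 0$, let $\tau_1$ be a permutation of $\{0,1,\ldots,k\}$, and let $p=(d_k,d_{k-1},\ldots,d_0)_b$ be an $(n,b,\tau_1)$-permutiple with carries $c_k,c_{k-1},\ldots,c_0$. Let $\psi$ be the $(k+1)$-cycle $(0,1,\ldots,k)$, and let $\pi$ be a permutation of $\{0,1,\ldots,k\}$. Then the following hold: 1. If, for some permutation $\tau_2$ of $\{0,1,\ldots,k\}$, $(d_{\pi(k)},d_{\pi(k-1)},\ldots,d_{\pi(0)})_b$ is an $(n,b,\tau_2)$-permutiple from the same conjugacy class as $p$, then $c_{\psi(j)}=c_{\pi\psi\pi^{-1}(j)}$ for all $0\le j\le k$. 2. If $c_{\pi(0)}=0$ and $c_{\psi(j)}=c_{\pi\psi\pi^{-1}(j)}$ for all $0\le j\le k$, then there is a permutation $\tau_2$ of $\{0,1,\ldots,k\}$ such that $(d_{\pi(k)},d_{\pi(k-1)},\ldots,d_{\pi(0)})_b$ is an $(n,b,\tau_2)$-permutiple from the same conjugacy class as $p$.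
   Context: For integers $0\le d_j<b$, $(d_k,d_{k-1},\ldots,d_0)_b$ denotes the natural number $\sum_{j=0}^k d_j b^j$ (leading zeros are allowed). For a permutation $\sigma$ of $\{0,1,\ldots,k\}$, $(d_k,\ldots,d_0)_b$ is an $(n,b,\sigma)$-permutiple if $(d_k,d_{k-1},\ldots,d_0)_b = n\,(d_{\sigma(k)},d_{\sigma(k-1)},\ldots,d_{\sigma(0)})_b$. Accordingly, $(d_{\pi(k)},\ldots,d_{\pi(0)})_b$ is an $(n,b,\tau)$-permutiple if $(d_{\pi(k)},\ldots,d_{\pi(0)})_b=n\,(d_{\pi\tau(k)},\ldots,d_{\pi\tau(0)})_b$. The carries of an $(n,b,\sigma)$-permutiple $(d_k,\ldots,d_0)_b$ are those of the usual single-digit multiplication of $(d_{\sigma(k)},\ldots,d_{\sigma(0)})_b$ by $n$ in base $b$: $c_0=0$ and $c_{j+1}=\left[n d_{\sigma(j)}+c_j-\lambda(n d_{\sigma(j)}+c_j)\right]/b$ for $0\le j\le k$, where $\lambda(x)$ is the least non-negative residue of $x$ modulo $b$; since the product has $k+1$ digits, $c_{k+1}=0$. Conjugacy: relative to the fixed digit sequence $(d_k,\ldots,d_0)$, an $(n,b,\tau_1)$-permutiple $(d_{\pi_1(k)},\ldots,d_{\pi_1(0)})_b$ and an $(n,b,\tau_2)$-permutiple $(d_{\pi_2(k)},\ldots,d_{\pi_2(0)})_b$ are conjugate (in the same conjugacy class) if $\pi_1\tau_1\pi_1^{-1}=\pi_2\tau_2\pi_2^{-1}$. For $p$ itself one takes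 $\pi_1$ to be the identity, so being in the same conjugacy class as $p$ means $\tau_1=\pi\tau_2\pi^{-1}$. Here $\psi(j)=j+1$ for $j<k$ and $\psi(k)=0$; products of permutations are compositions, applied right to left. *)

(* Defs.v *)
From mathcomp Require Import all_boot all_fingroup.
Set Implicit Arguments.
Unset Strict Implicit.
Unset Printing Implicit Defensive.

(* A digit string (d_k, ..., d_0)_b is a function d : 'I_k.+1 -> 'I_b; the
   index is the exponent of b, so d ord0 is the least significant digit, and
   leading zeros are allowed. *)
Definition digits_val (b k : nat) (d : 'I_k.+1 -> 'I_b) : nat :=
  \sum_(j < k.+1) d j * b ^ j.

Definition permute_digits (b k : nat) (d : 'I_k.+1 -> 'I_b)
    (s : {perm 'I_k.+1}) : 'I_k.+1 -> 'I_b :=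
  fun j => d (s j).

Definition permutiple (n b k : nat) (d : 'I_k.+1 -> 'I_b)
    (s : {perm 'I_k.+1}) : Prop :=
  digits_val d = n * digits_val (permute_digits d s).

(* The carries c_0, ..., c_{k+1}. The index i is a plain nat so that c_{k+1}
   exists; inord i is the position i for i <= k, and values at indices above
   k+1 are meaningless. The truncated subtraction and the division are exact. *)
Fixpoint carry (n b k : nat) (d : 'I_k.+1 -> 'I_b) (s : {perm 'I_k.+1})
    (j : nat) : nat :=
  if j is i.+1 then
    let x := n * d (s (inord i)) + carry n d s i in (x - x %% b) %/ b
  else 0.

(* The cycle (0, 1, ..., k): ordS j is j+1 modulo k+1. *)
Definition psi (k : nat) : {perm 'I_k.+1} := perm (@ordS_inj k.+1).

(* pi1 tau1 pi1^-1 = pi2 tau2 pi2^-1 for right-to-left composition; the product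
   of {perm _} applies its left factor first, so the factors are reversed. *)
Definition same_conj_class (k : nat) (pi1 tau1 pi2 tau2 : {perm 'I_k.+1}) :
    Prop :=
  (pi1^-1 * tau1 * pi1 = pi2^-1 * tau2 * pi2)%g.

(* Main.v *)
Require Import Defs.
From mathcomp Require Import all_boot all_fingroup.

(** Being a permutiple is a local condition.  Writing [c] for the carries,
    column [j] of the multiplication reads
      [n * d (s j) + c j = d j + b * c (psi j)],
    where [psi] closes up the column positions into a cycle because the carry
    into column [0] and the carry out of column [k] both vanish.  By uniqueness
    of base [b] expansions a permutiple satisfies these equations
    ([permutiple_column]); conversely, summing them against [b ^ j], with any
    [c] vanishing at [0], telescopes to the permutiple equation
    ([column_permutiple]).

    Conjugacy means [pi (tau2 j) = tau1 (pi j)] for all [j], so column [j] of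
    the permuted string involves the same two digits as column [pi j] of the
    original one; only the carries can differ.  Column [pi j] of the original string sends the carry
    [c (pi j)] in to the carry [c (psi (pi j))] out, whereas the permuted string
    needs a carry sequence [c'] sending [c' j] in to [c' (psi j)] out.

    Carries are smaller than [n], hence than [b], so the two digits of a column
    determine both of its carries: if the permuted string is a permutiple, then
    [c' j = c (pi j)] for every [j], and also [c' (psi j) = c (psi (pi j))],
    which together give [c (pi (psi j)) = c (psi (pi j))].  Conversely, if the
    latter holds and [c (pi 0) = 0], then [c' := c \o pi] satisfies the column
    equations of the permuted string. *)

Set Implicit Arguments.
Unset Strict Implicit.
Unset Printing Implicit Defensive.

(** Multiplying the [i]-th equation by [b ^ i] makes the carries telescope. *)
Lemma telescope_carries (b m : nat) (u r c : nat -> nat) :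
  (forall i, i < m -> u i + c i = r i + b * c i.+1) ->
  \sum_(i < m) u i * b ^ i + c 0 = \sum_(i < m) r i * b ^ i + c m * b ^ m.
Proof.
elim: m => [|m IHm] col; first by rewrite !big_ord0 expn0 muln1.
rewrite !big_ord_recr /= addnAC IHm => [|i lt_im]; last exact/col/ltnW.
by rewrite -!addnA -mulnDl [c m + _]addnC col // mulnDl expnS mulnCA mulnA.
Qed.

(** The leading parts [x], [y] are unbounded so that the induction can absorb
    the top digit into them. *)
Lemma base_expansion_inj (b m : nat) (f g : nat -> nat) (x y : nat) :
  (forall i, i < m -> f i < b) -> (forall i, i < m -> g i < b) ->
  \sum_(i < m) f i * b ^ i + x * b ^ m =
    \sum_(i < m) g i * b ^ i + y * b ^ m ->
  x = y /\ forall i, i < m -> f i = g i.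
Proof.
elim: m x y => [|m IHm] x y ltf ltg.
  by rewrite !big_ord0 expn0 !muln1.
rewrite !big_ord_recr /= !expnS !mulnA -!addnA -!mulnDl => eq_fg.
have [i lt_im|i lt_im|top eq_low] := IHm _ _ _ _ eq_fg.
- exact/ltf/ltnW.
- exact/ltg/ltnW.
have [fm_lt gm_lt] := (ltf m (ltnSn m), ltg m (ltnSn m)).
have fgm : f m = g m.
  move: (congr1 (modn^~ b) top).
  by rewrite /= ![_ + _ * b]addnC !modnMDl !modn_small.
split=> [|i]; last by rewrite ltnS leq_eqVlt => /predU1P[->|/eq_low].
move/eqP: top; rewrite fgm eqn_add2l eqn_pmul2r; first by move/eqP.
exact: leq_ltn_trans fm_lt.
Qed.

Section Columns.

Variables n b k : nat.
Implicit Types (d : 'I_k.+1 -> 'I_b) (s : {perm 'I_k.+1}) (j : 'I_k.+1).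

Lemma digits_val_inord d :
  digits_val d = \sum_(i < k.+1) (d (inord i) : nat) * b ^ i.
Proof. by apply: eq_bigr => i _; rewrite inord_val. Qed.

Lemma inord0 : inord 0 = ord0 :> 'I_k.+1.
Proof. by apply: val_inj; rewrite /= inordK. Qed.

Lemma inord_last : inord k.+1 = ord0 :> 'I_k.+1.
Proof. by rewrite /inord /insubd insubF ?ltnn. Qed.

(** At [i = k] both sides are [ord0], the default value of [inord]. *)
Lemma inordS i : i < k.+1 -> inord i.+1 = psi k (inord i) :> 'I_k.+1.
Proof.
move=> lt_ik; apply: val_inj; rewrite permE /= (inordK lt_ik).
move: lt_ik; rewrite ltnS leq_eqVlt => /predU1P[->|lt_ik].
  by rewrite modnn inord_last.
by rewrite inordK ?modn_small.
Qed.

Lemma column_permutiple d s (c : 'I_k.+1 -> nat) :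
  c ord0 = 0 ->
  (forall j, n * d (s j) + c j = d j + b * c (psi k j)) ->
  permutiple n d s.
Proof.
move=> c0 col; rewrite /permutiple !digits_val_inord big_distrr /=.
have := @telescope_carries b k.+1 (fun i => n * d (s (inord i)))
  (fun i => d (inord i)) (fun i => c (inord i)).
rewrite inord0 inord_last c0 mul0n !addn0 => <- => [|i lt_ik].
  by apply: eq_bigr => i _; rewrite mulnA.
by rewrite inordS.
Qed.

Lemma carryS d s i :
  carry n d s i.+1 = (n * d (s (inord i)) + carry n d s i) %/ b.
Proof.
rewrite /=; set x := _ + _.
have b_gt0 : 0 < b := leq_ltn_trans (leq0n _) (ltn_ord (d ord0)).
by rewrite {1}(divn_eq x b) addnK mulnK.
Qed.

Lemma carry_lt d s i : 0 < n -> carry n d s i < n.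
Proof.
move=> n_gt0; elim: i => [|i IHi] //; rewrite carryS.
have lt_db := ltn_ord (d (s (inord i))).
rewrite ltn_divLR; last exact: leq_ltn_trans lt_db.
apply: (@leq_trans (n * (d (s (inord i))).+1)).
  by rewrite mulnS addnC ltn_add2r.
by rewrite leq_mul2l lt_db orbT.
Qed.

(** The residues written down by the multiplication, followed by the last
    carry, form a base [b] expansion of [n * digits_val (permute_digits d s)];
    so do the digits of [d], followed by [0]. *)
Lemma permutiple_carries d s : permutiple n d s ->
  carry n d s k.+1 = 0 /\
  forall i, i < k.+1 ->
    n * d (s (inord i)) + carry n d s i = d (inord i) + b * carry n d s i.+1.
Proof.
move=> pd; pose u i := n * d (s (inord i)).
pose r i := (u i + carry n d s i) %% b.
have step i : u i + carry n d s i = r i + b * carry n d s i.+1.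
  by rewrite carryS mulnC addnC [in RHS]addnC addnC -divn_eq.
have tele := @telescope_carries b k.+1 u r (carry n d s) (fun i _ => step i).
have b_gt0 : 0 < b := leq_ltn_trans (leq0n _) (ltn_ord (d ord0)).
have [i _|i _||last_carry eq_rd] := @base_expansion_inj b k.+1 r
    (fun i => d (inord i)) (carry n d s k.+1) 0.
- exact: ltn_pmod.
- exact: ltn_ord.
- rewrite -tele mul0n !addn0 -digits_val_inord pd digits_val_inord big_distrr.
  by apply: eq_bigr => i _; rewrite /u -mulnA.
by split=> // i lt_ik; rewrite -eq_rd //; exact: step.
Qed.

Lemma permutiple_column d s j : permutiple n d s ->
  n * d (s j) + carry n d s j = d j + b * carry n d s (psi k j).
Proof.
case/permutiple_carries=> last_carry /(_ j (ltn_ord j)).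
rewrite inord_val => ->; congr (_ + b * _).
have -> : psi k j = j.+1 %% k.+1 :> nat by rewrite permE.
have:= ltn_ord j; rewrite ltnS leq_eqVlt => /predU1P[->|lt_jk].
  by rewrite modnn last_carry.
by rewrite modn_small.
Qed.

End Columns.

(** Modulo [b], the incoming carry is [r - v]; being smaller than [b] it is
    determined, and then so is the outgoing one. *)
Lemma column_carries_inj (b v r x y x' y' : nat) :
  x < b -> x' < b ->
  v + x = r + b * y -> v + x' = r + b * y' -> x = x' /\ y = y'.
Proof.
move=> lt_xb lt_x'b eq1 eq2.
have eqx : x = x'.
  have : v + x = v + x' %[mod b] by rewrite eq1 eq2 ![r + _]addnC ![b * _]mulnC !modnMDl.
  by move/eqP; rewrite eqn_modDl !modn_small // => /eqP.
split=> //; move/eqP: eq2; rewrite -eqx eq1 eqn_add2l eqn_pmul2l.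
  by move/eqP.
exact: leq_ltn_trans lt_xb.
Qed.

Theorem corollary12 (n b k : nat) (hn : 1 < n) (hnb : n < b)
    (d : 'I_k.+1 -> 'I_b) (tau1 : {perm 'I_k.+1})
    (hp : permutiple n d tau1) (pi : {perm 'I_k.+1}) :
  ((exists tau2 : {perm 'I_k.+1},
       permutiple n (permute_digits d pi) tau2 /\
       same_conj_class 1%g tau1 pi tau2) ->
   forall j : 'I_k.+1,
     carry n d tau1 (psi k j) = carry n d tau1 (pi (psi k ((pi^-1)%g j))))
  /\
  (carry n d tau1 (pi ord0) = 0 ->
   (forall j : 'I_k.+1,
     carry n d tau1 (psi k j) = carry n d tau1 (pi (psi k ((pi^-1)%g j)))) ->
   exists tau2 : {perm 'I_k.+1},
     permutiple n (permute_digits d pi) tau2 /\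
     same_conj_class 1%g tau1 pi tau2).
Proof.
split=> [[tau2 [hq]]|c_pi0 commute].
  rewrite /same_conj_class invg1 mul1g mulg1 => tau1E.
  have carries i : carry n d tau1 (pi i) = carry n (permute_digits d pi) tau2 i
      /\ carry n d tau1 (psi k (pi i)) =
         carry n (permute_digits d pi) tau2 (psi k i).
    have same_digit : pi (tau2 i) = tau1 (pi i) by rewrite tau1E !permM permK.
    have := permutiple_column i hq; rewrite /permute_digits same_digit.
    apply: column_carries_inj (permutiple_column (pi i) hp);
      by apply: ltn_trans hnb; apply/carry_lt/ltnW.
  move=> j; have [_] := carries ((pi^-1)%g j); rewrite permKV => ->.
  by have [-> _] := carries (psi k ((pi^-1)%g j)).
(* Left factors act first, so this is [j |-> pi^-1 (tau1 (pi j))]. *)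
exists (pi * tau1 * pi^-1)%g; split; last first.
  by rewrite /same_conj_class invg1 mul1g mulg1 !mulgA mulVg mul1g mulgKV.
apply: (column_permutiple (c := fun j => carry n d tau1 (pi j))) => // j.
have := permutiple_column (pi j) hp.
by rewrite commute permK /permute_digits !permM permKV.
Qed.
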